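(* Let $\mathcal X,\mathcal Y,\mathcal Z$ be finite sets, $f\colon\mathcal X\times\mathcal Y\to\mathcal Z$ arbitrary, and $\mu$ a distribution on $\mathcal X\times\mathcal Y$. The following are equivalent: (a) $\mu$ is external-trivial; (b) $\mu$ is strongly external-trivial; (c) $\mu$ is structurally external-trivial.
   Context: Two-party randomized protocols with public and private randomness; transcript $\Pi$ consists of public randomness and exchanged bits. For $(X,Y)\sim\mu$, $\mathrm{IC}^{\mathrm{ext}}_\mu(\pi)=I(\Pi;XY)$; $\mathrm{IC}^{\mathrm{ext}}_\mu(f,0)$ is the infimum of $\mathrm{IC}^{\mathrm{ext}}_\mu(\pi)$ over protocols computing $f$ correctly with probability 1 on every input. $\mu$ is external-trivial if $\mathrm{IC}^{\mathrm{ext}}_\mu(f,0)=0$; strongly external-trivial if some protocol $\pi$ computing $f$ correctly on all inputs has $\mathrm{IC}^{\mathrm{ext}}_\mu(\pi)=0$; structurally external-trivial if $f$ is constant on $S_A\times S_B$, where $S_A\subseteq\mathcal X$ and $S_B\subseteq\mathcal Y$ are the supports of the marginals of $\mu$. *)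

(* Defs.v *)
From HB Require Import structures.
From mathcomp Require Import all_boot all_order all_algebra.
From mathcomp Require Import all_classical all_reals all_analysis.

Set Implicit Arguments.
Unset Strict Implicit.
Unset Printing Implicit Defensive.
Import Order.TTheory GRing.Theory Num.Theory.

Local Open Scope classical_set_scope.
Local Open Scope ring_scope.
Local Open Scope ereal_scope.

(* Measurable types are pointed in the library, hence finite nonempty sets;
   only nonempty finite sets carry a probability distribution anyway. *)
#[short(type=finPointedType)]
HB.structure Definition FinPointed := {T of Finite T & Pointed T}.

(* T with the sigma-algebra of all its subsets. *)
Definition discrete (T : pointedType) : Type := T.

HB.instance Definition _ (T : pointedType) := Pointed.on (discrete T).
HB.instance Definition _ (T : pointedType) :=
  @isMeasurable.Build default_measure_display (discrete T) discrete_measurable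
    discrete_measurable0 discrete_measurableC discrete_measurableU.

HB.instance Definition _ := isPointed.Build (seq bool) [::].

Section independent_product.
Context d1 d2 (T1 : measurableType d1) (T2 : measurableType d2) (R : realType).
Context (P1 : probability T1 R) (P2 : probability T2 R).

Definition product_probability : set (T1 * T2) -> \bar R := P1 \x P2.

HB.instance Definition _ := Measure.on product_probability.

Let product_probability_setT : product_probability [set: T1 * T2] = 1.
Proof.
rewrite -setXTT [LHS](product_measure1E P1 P2)// -[RHS]mule1.
by congr (_ * _); exact: probability_setT.
Qed.

HB.instance Definition _ := Measure_isProbability.Build _ _ _
  product_probability product_probability_setT.

End independent_product.

HB.instance Definition _ d1 d2 (T1 : measurableType d1)
    (T2 : measurableType d2) :=
  isMeasurableFun.Build _ _ (T1 * T2)%type T2 snd measurable_snd.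

Definition log2 (R : realType) (x : R) : R := (ln x / ln 2)%R.

(* D(P || Q), in bits. *)
Definition kl_divergence d (T : measurableType d) (R : realType)
    (P Q : probability T R) : \bar R :=
  if pselect (P `<< Q) then
    \int[P]_t (log2 (fine (Radon_Nikodym (charge_of_finite_measure P) Q t)))%:E
  else +oo.

Section mutual_information.
Context d d1 d2 (T : measurableType d) (T1 : measurableType d1)
  (T2 : measurableType d2) (R : realType) (P : probability T R).

Definition pair_rv (U : {RV P >-> T1}) (V : {RV P >-> T2}) (t : T) : T1 * T2 :=
  (U t, V t).

Let measurable_pair_rv (U : {RV P >-> T1}) (V : {RV P >-> T2}) :
  measurable_fun [set: T] (pair_rv U V).
Proof. by apply: measurable_fun_pair. Qed.

HB.instance Definition _ (U : {RV P >-> T1}) (V : {RV P >-> T2}) :=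
  isMeasurableFun.Build _ _ _ _ (pair_rv U V) (measurable_pair_rv U V).

(* I(U;V): the divergence of the joint law from the product of the marginals. *)
Definition mutual_info (U : {RV P >-> T1}) (V : {RV P >-> T2}) : \bar R :=
  kl_divergence (distribution P (pair_rv U V))
    (product_probability (distribution P U) (distribution P V)).

End mutual_information.

(* Protocol trees.  At an internal node the owner sends a bit depending on her
   own input, the public randomness (in T0) and her own private randomness (in
   TA or TB); the bit 1 leads to the first subtree and 0 to the second one.
   The output at a leaf is a function of the public randomness, so that it is
   determined by the transcript. *)
Inductive protocol_tree d0 dA dB (T0 : measurableType d0)
    (TA : measurableType dA) (TB : measurableType dB)
    (X Y Z : finPointedType) : Type :=
| Leaf of {mfun T0 >-> discrete Z}
| Alice of (X -> {mfun (T0 * TA)%type >-> bool})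
    & protocol_tree T0 TA TB X Y Z & protocol_tree T0 TA TB X Y Z
| Bob of (Y -> {mfun (T0 * TB)%type >-> bool})
    & protocol_tree T0 TA TB X Y Z & protocol_tree T0 TA TB X Y Z.

(* A random point is (r, (ra, rb)): public, Alice's and Bob's randomness. *)
Section execution.
Context d0 dA dB (T0 : measurableType d0)
    (TA : measurableType dA) (TB : measurableType dB) (X Y Z : finPointedType).

Fixpoint exchanged_bits (t : protocol_tree T0 TA TB X Y Z) (x : X) (y : Y)
    (w : T0 * (TA * TB)) : seq bool :=
  match t with
  | Leaf _ => [::]
  | Alice m t1 t0 => if m x (w.1, w.2.1) then true :: exchanged_bits t1 x y w
                     else false :: exchanged_bits t0 x y w
  | Bob m t1 t0 => if m y (w.1, w.2.2) then true :: exchanged_bits t1 x y w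
                   else false :: exchanged_bits t0 x y w
  end.

Fixpoint tree_output (t : protocol_tree T0 TA TB X Y Z) (x : X) (y : Y)
    (w : T0 * (TA * TB)) : Z :=
  match t with
  | Leaf out => out w.1
  | Alice m t1 t0 => if m x (w.1, w.2.1) then tree_output t1 x y w
                     else tree_output t0 x y w
  | Bob m t1 t0 => if m y (w.1, w.2.2) then tree_output t1 x y w
                   else tree_output t0 x y w
  end.

Definition tree_transcript (t : protocol_tree T0 TA TB X Y Z)
    (w : (T0 * (TA * TB)) * discrete (X * Y)%type) :
    T0 * discrete (seq bool) :=
  (w.1.1, exchanged_bits t w.2.1 w.2.2 w.1).

Let measurable_section (t : protocol_tree T0 TA TB X Y Z) x y :
  measurable_fun [set: T0 * (TA * TB)]
    (exchanged_bits t x y : _ -> discrete (seq bool)).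
Proof.
have mcons b (g : T0 * (TA * TB) -> discrete (seq bool)) :
    measurable_fun [set: T0 * (TA * TB)] g ->
    measurable_fun [set: T0 * (TA * TB)]
      (fun w => b :: g w : discrete (seq bool)).
  by move=> mg; apply: (measurableT_comp _ mg) => _ S _.
elim: t => [out|m t1 mt1 t0 mt0|m t1 mt1 t0 mt0] /=.
- exact: measurable_cst.
- apply: measurable_fun_ifT; [|exact: mcons|exact: mcons].
  apply: (measurableT_comp (f := m x)) => //.
  by apply: measurable_fun_pair => //; apply: measurableT_comp.
- apply: measurable_fun_ifT; [|exact: mcons|exact: mcons].
  apply: (measurableT_comp (f := m y)) => //.
  by apply: measurable_fun_pair => //; apply: measurableT_comp.
Qed.

Let measurable_tree_transcript (t : protocol_tree T0 TA TB X Y Z) :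
  measurable_fun [set: (T0 * (TA * TB)) * discrete (X * Y)%type]
    (tree_transcript t).
Proof.
apply: measurable_fun_pair; first exact: measurableT_comp.
move=> _ S _; rewrite setTI.
have -> : (fun w : (T0 * (TA * TB)) * discrete (X * Y)%type =>
      exchanged_bits t w.2.1 w.2.2 w.1) @^-1` S =
    \bigcup_(p in [set: X * Y])
      ((exchanged_bits t p.1 p.2 @^-1` S) `*` [set p]).
  apply/seteqP; split => [[w p] /= Sw|[w p] /= [q _ [/= Sw ->]]//].
  by exists p.
apply: fin_bigcup_measurable => // p _.
apply: measurableX => //.
by rewrite -[X in measurable X]setTI; apply: measurable_section.
Qed.

HB.instance Definition _ (t : protocol_tree T0 TA TB X Y Z) :=
  isMeasurableFun.Build _ _ _ _ (tree_transcript t)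
    (measurable_tree_transcript t).

End execution.

(* The public and the two private random strings range over arbitrary
   probability spaces. *)
Record protocol (R : realType) (X Y Z : finPointedType) := Protocol {
  pub_display : measure_display;
  alice_display : measure_display;
  bob_display : measure_display;
  pub_space : measurableType pub_display;
  alice_space : measurableType alice_display;
  bob_space : measurableType bob_display;
  pub_law : probability pub_space R;
  alice_law : probability alice_space R;
  bob_law : probability bob_space R;
  tree : protocol_tree pub_space alice_space bob_space X Y Z
}.

Section external_information.
Context (R : realType) (X Y Z : finPointedType).

Definition randomness (pi : protocol R X Y Z) :
    probability (pub_space pi * (alice_space pi * bob_space pi))%type R :=
  product_probability (pub_law pi)
    (product_probability (alice_law pi) (bob_law pi)).

Definition computes (pi : protocol R X Y Z) (f : X * Y -> Z) : Prop :=
  forall x y,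
    randomness pi [set w | tree_output (tree pi) x y w = f (x, y)] = 1.

Section information_cost.
Context (mu : probability (discrete (X * Y)%type) R).

Definition joint_law (pi : protocol R X Y Z) :
    probability ((pub_space pi * (alice_space pi * bob_space pi))
                 * discrete (X * Y))%type R :=
  product_probability (randomness pi) mu.

Definition transcript (pi : protocol R X Y Z) :
    {RV joint_law pi >-> (pub_space pi * discrete (seq bool))%type} :=
  tree_transcript (tree pi).

Definition inputs (pi : protocol R X Y Z) :
    {RV joint_law pi >-> discrete (X * Y)%type} := snd.

Definition ic_ext (pi : protocol R X Y Z) : \bar R :=
  mutual_info (transcript pi) (inputs pi).

(* IC^ext_mu(f, 0) *)
Definition ic_ext_zero_error (f : X * Y -> Z) : \bar R :=
  ereal_inf [set c | exists2 pi : protocol R X Y Z,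
                       computes pi f & c = ic_ext pi].

Definition external_trivial (f : X * Y -> Z) : Prop :=
  ic_ext_zero_error f = 0.

Definition strongly_external_trivial (f : X * Y -> Z) : Prop :=
  exists2 pi : protocol R X Y Z, computes pi f & ic_ext pi = 0.

Definition support_A : set X := [set x | 0 < mu [set p | p.1 = x]].

Definition support_B : set Y := [set y | 0 < mu [set p | p.2 = y]].

Definition structurally_external_trivial (f : X * Y -> Z) : Prop :=
  exists z, forall p, (support_A `*` support_B) p -> f p = z.

End information_cost.
End external_information.

(* Main.v *)
Require Import Defs.
From mathcomp Require Import all_boot all_order all_algebra.
From mathcomp Require Import all_classical all_reals all_analysis.
From mathcomp Require Import measurable_realfun lra.

(* Given the public randomness r, a transcript s has probability
   alpha_{x,s}(r) * beta_{y,s}(r) on input (x, y).  If, for some s, all the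
   alpha_{x,s} (x in S_A) and beta_{y,s} (y in S_B) are nonzero on a set of r of
   positive probability, then the zero-error output at (r, s) is the value of f
   at every point of S_A x S_B.  Otherwise almost every (r, s) is incompatible
   with an atom of mu, so the set of compatible triples, which has full measure
   under the joint law, has measure at most 1 - m under the product of the
   marginals, where m in (0, 1) is a lower bound for the masses of the atoms;
   hence the external information cost is at least - log2 (1 - m) > 0, a bound
   independent of the protocol. *)

Set Implicit Arguments.
Unset Strict Implicit.
Unset Printing Implicit Defensive.
Import Order.TTheory GRing.Theory Num.Theory.

Local Open Scope classical_set_scope.
Local Open Scope ring_scope.
Local Open Scope ereal_scope.

(** * Lower bounds on the Kullback-Leibler divergence *)

Section divergence_bound.
Context d (T : measurableType d) (R : realType) (P Q : probability T R).

Hypothesis PQ : P `<< Q.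

Let RN := Radon_Nikodym (charge_of_finite_measure P) Q.
Let h t : R := fine (RN t).

Let mRN : measurable_fun [set: T] RN.
Proof. by apply: measurable_int; exact: Radon_Nikodym_integrable. Qed.

Let mh : measurable_fun [set: T] h.
Proof. exact: measurableT_comp. Qed.

Let RNE t : RN t = (h t)%:E.
Proof. by rewrite fineK// Radon_Nikodym_fin_num. Qed.

Let mpos : measurable [set t | (0 < h t)%R].
Proof.
have -> : [set t | (0 < h t)%R] = [set: T] `&` h @^-1` `]0%R, +oo[.
  by rewrite setTI; apply/seteqP; split=> t /=; rewrite in_itv/= andbT.
exact: mh.
Qed.

(** The [P]-mass of a set is the [Q]-integral of the density over it, and here the integrand is at
    most 0. *)
Lemma density_gt0 : P (~` [set t | (0 < h t)%R]) = 0.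
Proof.
have mN := measurableC mpos.
apply/eqP; rewrite eq_le measure_ge0 andbT.
have -> : P (~` [set t | (0 < h t)%R]) =
    \int[Q]_(t in ~` [set t | (0 < h t)%R]) RN t.
  by rewrite -Radon_Nikodym_integral.
rewrite -[leRHS](integral0 Q (~` [set t | (0 < h t)%R])).
apply: le_integral => //.
- apply: (@integrableS _ _ _ _ setT) => //; exact: Radon_Nikodym_integrable.
- exact: integrable0.
- by move=> t; rewrite inE/= RNE lee_fin => /negP; rewrite -leNgt.
Qed.

(** Change of variables dP = h dQ turns the integrand 1/h into 1. Writing 1/h as [expR (- ln (h t))]
    gives measurability by composition and fits the inequality 1 + x <= exp x used below. *)
Lemma integral_inv_density (D : set T) :
  measurable D -> D `<=` [set t | (0 < h t)%R] ->
  \int[P]_(t in D) (expR (- ln (h t)))%:E = Q D.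
Proof.
move=> mD Dpos.
have mu : measurable_fun D (fun t => (expR (- ln (h t)))%:E).
  apply: measurable_funTS; apply/measurable_EFinP.
  apply: measurableT_comp => //; apply: measurableT_comp => //.
  by apply: measurableT_comp => //; exact: measurable_ln.
rewrite -(Radon_Nikodym_SigmaFinite.change_of_variables PQ)//.
rewrite (@ae_eq_integral _ _ _ _ _ (cst 1)) ?integral_cst ?mul1e//.
  apply: emeasurable_funM => //; apply: measurable_funTS.
  by apply: measurable_int; exact: Radon_Nikodym_SigmaFinite.f_integrable.
have := ae_eq_Radon_Nikodym_SigmaFinite PQ mD.
apply: filterS => t /= + Dt => -> //.
have ht := Dpos _ Dt; rewrite /= in ht.
rewrite [X in _ * X]RNE -EFinM expRN lnK ?posrE// mulVf//.
by rewrite gt_eqF.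
Qed.

(** This is Jensen's inequality: the [P]-mean of log h is at least -log of the [P]-mean of 1/h, and
    the latter mean is at most q on [E]. It is proved from the tangent bound 1 + x <= exp x, which
    is also meaningful when log h is not integrable. *)
Lemma integral_log2_density_ge (E : set T) (q : R) :
  (0 < q <= 1)%R -> measurable E -> P (~` E) = 0 -> Q E <= q%:E ->
  (- log2 q)%:E <= \int[P]_t (log2 (h t))%:E.
Proof.
move=> /andP[q0 q1] mE PE QE.
(* On [D], still of full [P]-measure, the logarithm of the density is the genuine one. *)
pose D := E `&` [set t | (0 < h t)%R].
have mD : measurable D by exact: measurableI.
have PD : P (~` D) = 0.
  apply/negligibleP; first exact: measurableC.
  rewrite setCI; apply: negligibleU; apply/negligibleP => //;
    try exact: measurableC.
  exact: density_gt0.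
have ln2 : (0 < ln 2 :> R)%R by rewrite ln_gt0// ltr1n.
have mL : measurable_fun [set: T] (fun t => (log2 (h t))%:E).
  apply/measurable_EFinP; rewrite /log2; apply: measurable_funM => //.
  by apply: measurableT_comp => //; exact: measurable_ln.
have intD (f : T -> \bar R) : measurable_fun [set: T] f ->
    (forall t, 0 <= f t) -> \int[P]_t f t = \int[P]_(t in D) f t.
  move=> mf f0; rewrite (ge0_negligible_integral _ _ _ _ PD)//; last first.
    exact: measurableC.
  by rewrite setTD setCK.
(* The integral is by definition a difference of two nonnegative integrals; each is bounded
   separately, since either could a priori be infinite. *)
rewrite integralE intD; last 2 first.
- exact: measurable_funepos.
- by move=> t; exact: funepos_ge0.
rewrite intD; last 2 first.
- exact: measurable_funeneg.
- by move=> t; exact: funeneg_ge0.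
set Lp := (X in \int[P]_(_ in D) X _ - _).
set Lm := (X in _ - \int[P]_(_ in D) X _).
have mLp : measurable_fun D Lp.
  by apply: measurable_funTS; exact: measurable_funepos.
have mLm : measurable_fun D Lm.
  by apply: measurable_funTS; exact: measurable_funeneg.
pose u t := expR (- ln (h t)).
have mu : measurable_fun D (fun t => (u t)%:E).
  apply: measurable_funTS; apply/measurable_EFinP.
  apply: measurableT_comp => //; apply: measurableT_comp => //.
  by apply: measurableT_comp => //; exact: measurable_ln.
have intu : \int[P]_(t in D) (u t)%:E <= q%:E.
  rewrite integral_inv_density//; last by move=> t [].
  apply: (le_trans _ QE); apply: le_measure; rewrite ?inE//.
  by move=> t [].
have PD1 : P D = 1.
  rewrite -[D]setCK probability_setC ?PD ?sube0//; exact: measurableC.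
have LpE t : Lp t = (Num.max (log2 (h t)) 0)%:E.
  by rewrite /Lp funeposE EFin_max.
have LmE t : Lm t = (Num.max (- log2 (h t)) 0)%:E.
  by rewrite /Lm funenegE EFin_max.
have Lp0 t : 0 <= Lp t by exact: funepos_ge0.
have Lm0 t : 0 <= Lm t by exact: funeneg_ge0.
have lnE t : ln (h t) = (ln 2 * log2 (h t))%R.
  by rewrite /log2 mulrCA mulfV ?mulr1// gt_eqF.
(* This makes both sides of [ineq2] nonnegative, so that monotonicity applies without
   integrability. *)
have lnq : (0 <= 1 - ln q)%R.
  by rewrite subr_ge0; exact: le_trans (ln_le0 q1) ler01.
(* The next two bounds are [- ln h <= 1 / h] and [1 - ln (q h) <= 1 / (q h)]. *)
have ineq1 : \int[P]_(t in D) ((ln 2)%:E * Lm t) <= \int[P]_(t in D) (u t)%:E.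
  apply: ge0_le_integral => //.
  - by move=> t _; apply: mule_ge0 => //; exact: ltW.
  - by apply: emeasurable_funM => //; exact: measurable_cst.
  - move=> t _; rewrite LmE -EFinM lee_fin /u.
    have := expR_ge1Dx (- ln (h t)); have := expR_ge0 (- ln (h t)).
    rewrite lnE; move: (log2 (h t)) (expR _) => a b.
    by case: (lerP (- a) 0); nra.
have ineq2 : \int[P]_(t in D) ((1 - ln q)%:E + (ln 2)%:E * Lm t) <=
    \int[P]_(t in D) ((q^-1)%:E * (u t)%:E + (ln 2)%:E * Lp t).
  apply: ge0_le_integral => //.
  - move=> t _; apply: adde_ge0.
      by rewrite lee_fin.
    by apply: mule_ge0 => //; exact: ltW.
  - apply: emeasurable_funD; first exact: measurable_cst.
    by apply: emeasurable_funM => //; exact: measurable_cst.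
  - apply: emeasurable_funD; apply: emeasurable_funM => //;
      exact: measurable_cst.
  - move=> t _; rewrite LmE LpE -!EFinM -!EFinD lee_fin /u.
    have := expR_ge1Dx (- ln q - ln (h t)).
    rewrite expRD -lnV ?posrE// lnK ?posrE ?invr_gt0// lnV ?posrE// lnE.
    move: (log2 (h t)) => a.
    by case: (lerP (- a) 0); case: (lerP a 0) => ? ?; nra.
have ln2' := ltW ln2.
have qV0 : (0 <= q^-1)%R by rewrite invr_ge0 ltW.
(* By [ineq1] the negative part has integral at most q / ln 2, which excludes the form oo - oo. *)
have fLm : \int[P]_(t in D) Lm t \is a fin_num.
  rewrite ge0_fin_numE; last exact: integral_ge0.
  rewrite ge0_integralZl_EFin// in ineq1.
  have := le_lt_trans (le_trans ineq1 intu) (ltry _).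
  move=> H; rewrite ltNge leye_eq; apply/negP => /eqP Z; move: H; rewrite Z.
  by rewrite gt0_muley ?lte_fin// ltxx.
move: ineq2.
rewrite ge0_integralD//; last 2 first.
- by move=> t _; apply: mule_ge0.
- by apply: emeasurable_funM => //; exact: measurable_cst.
rewrite ge0_integralD//; last 4 first.
- by move=> t _; rewrite -EFinM lee_fin mulr_ge0// ?invr_ge0 ?expR_ge0 ?ltW.
- by apply: emeasurable_funM => //; exact: measurable_cst.
- by move=> t _; apply: mule_ge0 => //; exact: ltW.
- by apply: emeasurable_funM => //; exact: measurable_cst.
rewrite !ge0_integralZl_EFin//; last first.
  by move=> t _; rewrite lee_fin expR_ge0.
rewrite (integral_cst P mD (1 - ln q)%:E) [X in _ * X + _ <= _]PD1 mule1.
have fu : \int[P]_(t in D) (u t)%:E \is a fin_num.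
  rewrite ge0_fin_numE; last first.
    by apply: integral_ge0 => t _; rewrite lee_fin expR_ge0.
  by apply: le_lt_trans intu _; rewrite ltry.
(* If the positive part has infinite integral the bound is trivial; otherwise [ineq2] is an
   inequality between reals, and the integral of 1/h is at most q. *)
have : 0 <= \int[P]_(t in D) Lp t by exact: integral_ge0.
case: (\int[P]_(t in D) Lp t) => [a| |] // _; last first.
  by rewrite -(fineK fLm) => _; rewrite addye// leey.
move: intu; rewrite -(fineK fLm) -(fineK fu) -!EFinM -!EFinD !lee_fin.
move: (fine _) (fine _) => b c cq H.
have qc : (q^-1 * c <= 1)%R by rewrite ler_pdivrMl// mulr1.
rewrite /log2 -mulNr ler_pdivrMr//; nra.
Qed.

End divergence_bound.

(** Data processing for the indicator of [E]: an event certain under [P] and of [Q]-mass at most q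
    costs at least log(1/q) bits. Without absolute continuity the divergence is infinite. *)
Lemma kl_divergence_ge d (T : measurableType d) (R : realType)
  (P Q : probability T R) (E : set T) (q : R) : (0 < q <= 1)%R ->
  measurable E -> P (~` E) = 0 -> Q E <= q%:E ->
  (- log2 q)%:E <= kl_divergence P Q.
Proof.
rewrite /kl_divergence; case: pselect => [PQ|nPQ]; last by rewrite leey.
exact: integral_log2_density_ge.
Qed.

(** Gibbs' inequality is the case of the whole space with q = 1. *)
Lemma kl_divergence_ge0 d (T : measurableType d) (R : realType)
  (P Q : probability T R) : 0 <= kl_divergence P Q.
Proof.
have := @kl_divergence_ge _ _ _ P Q setT 1%R.
rewrite /log2 ln1 mul0r oppr0; apply => //; first by rewrite ltr01 lexx.
  by rewrite setCT measure0.
by rewrite probability_setT.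
Qed.

(** The density has the same integral as the constant 1 over every measurable set, so it is 1 almost
    everywhere and its logarithm vanishes. *)
Lemma kl_divergence_eq0 d (T : measurableType d) (R : realType)
  (P Q : probability T R) :
  (forall A, measurable A -> P A = Q A) -> kl_divergence P Q = 0.
Proof.
move=> PQE; rewrite /kl_divergence.
have PQ : P `<< Q.
  apply/null_content_dominatesP => A mA; rewrite PQE//.
case: pselect => // PQ'.
set RN := Radon_Nikodym _ _.
have RN1 : ae_eq Q setT RN (cst 1).
  apply: integral_ae_eq => //.
  - exact: Radon_Nikodym_integrable.
  - move=> A _ mA; rewrite integral_cst// mul1e.
    rewrite -Radon_Nikodym_integral//; exact: PQE.
have RN1P : ae_eq P setT RN (cst 1) by exact: null_dominates_ae_eq RN1.
rewrite (ae_eq_integral (cst 0)) ?integral0//.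
  apply/measurable_EFinP; rewrite /log2; apply: measurable_funM => //.
  have mh : measurable_fun [set: T] (fun t => fine (RN t)).
    apply: measurableT_comp => //.
    by apply: measurable_int; exact: Radon_Nikodym_integrable.
  by apply: measurableT_comp => //; exact: measurable_ln.
by apply: filterS RN1P => t /= /(_ I) -> _ /=; rewrite /log2 ln1 mul0r.
Qed.

(** * Countable unions of null sets and atoms of the input distribution *)

Lemma negligible_countable_bigcup d (T : measurableType d) (R : realType)
    (mu : {measure set T -> \bar R}) (I : countType) (F : I -> set T) :
  (forall i, mu.-negligible (F i)) -> mu.-negligible (\bigcup_i F i).
Proof.
move=> NF.
have : mu.-negligible (\bigcup_n (if unpickle n is Some i then F i else set0)).
  apply: negligible_bigcup => n; case: unpickle => [i|]; first exact: NF.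
  exact: negligible_set0.
apply: negligibleS => t [i _ Fit]; exists (pickle i) => //.
by rewrite pickleK.
Qed.

Section atoms.
Context (R : realType) (X Y : finPointedType)
  (mu : probability (discrete (X * Y)%type) R).

Lemma exists_atom (A : set (X * Y)) :
  0 < mu A -> exists2 x, A x & 0 < mu [set x].
Proof.
move=> muA; apply: contrapT => noatom.
suff : mu A = 0 by move=> muA0; rewrite muA0 ltxx in muA.
apply/negligibleP => //.
have : mu.-negligible (\bigcup_(x : X * Y) (A `&` [set x])).
  apply: negligible_countable_bigcup => x; apply/negligibleP => //.
  have [Ax|nAx] := pselect (A x).
    apply/eqP; rewrite eq_le measure_ge0 andbT leNgt; apply/negP => mux.
    apply: noatom; exists x => //; apply: lt_le_trans mux _.
    by apply: le_measure; rewrite ?inE//; apply: subIsetr.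
  rewrite (_ : _ `&` _ = set0) ?measure0//.
  by apply/seteqP; split=> // y [/= Ay yx]; rewrite -yx in nAx.
by apply: negligibleS => x Ax; exists x.
Qed.

Lemma exists_min_atom : exists2 m : R, (0 < m < 1)%R &
  forall x, 0 < mu [set x] -> m%:E <= mu [set x].
Proof.
(* The default 1/2 of the minimum keeps m < 1 even when [mu] is a point mass, so that log2 (1 - m)
   is a genuine logarithm. *)
pose m : R :=
  (\big[Num.min/2^-1]_(x : X * Y | (0 < mu [set x])%E) fine (mu [set x]))%R.
have fin x : mu [set x] \is a fin_num by exact: fin_num_measure.
exists m.
  apply/andP; split.
    apply: lt_bigmin; rewrite ?invr_gt0// => x.
    by rewrite -[X in 0 < X]fineK// lte_fin.
  by apply: le_lt_trans (bigmin_le_id _ _ _ _) _; rewrite invf_lt1// ltr1n.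
by move=> x mux; rewrite -[leRHS]fineK// lee_fin; exact: bigmin_le_cond.
Qed.

End atoms.

(** * The rectangle structure of transcripts *)

Section transcript_cells.
Context d0 dA dB (T0 : measurableType d0) (TA : measurableType dA)
  (TB : measurableType dB) (X Y Z : finPointedType).

(* The coins (r, ra) with which Alice, on input x, follows the bits s; the event
   that the exchanged bits are s is then a rectangle in (ra, rb) for every r. *)
Fixpoint alice_cell (t : protocol_tree T0 TA TB X Y Z) (x : X) (s : seq bool) :
    set (T0 * TA) :=
  match t, s with
  | Leaf _, [::] => setT
  | Alice m t1 t0, b :: s' =>
      (m x : T0 * TA -> bool) @^-1` [set b] `&`
      alice_cell (if b then t1 else t0) x s'
  | Bob _ t1 t0, b :: s' => alice_cell (if b then t1 else t0) x s'
  | _, _ => set0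
  end.

Fixpoint bob_cell (t : protocol_tree T0 TA TB X Y Z) (y : Y) (s : seq bool) :
    set (T0 * TB) :=
  match t, s with
  | Leaf _, [::] => setT
  | Alice _ t1 t0, b :: s' => bob_cell (if b then t1 else t0) y s'
  | Bob m t1 t0, b :: s' =>
      (m y : T0 * TB -> bool) @^-1` [set b] `&`
      bob_cell (if b then t1 else t0) y s'
  | _, _ => set0
  end.

(** The output read off the bits alone, without the inputs; [cst point] fills in for strings that
    end before a leaf. *)
Fixpoint leaf_output (t : protocol_tree T0 TA TB X Y Z) (s : seq bool) :
    T0 -> discrete Z :=
  match t, s with
  | Leaf out, _ => out
  | Alice _ t1 t0, b :: s' => leaf_output (if b then t1 else t0) s'
  | Bob _ t1 t0, b :: s' => leaf_output (if b then t1 else t0) s'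
  | _, [::] => cst point
  end.

(** The rectangle property: the bit sent at a node constrains only the input and coins of its owner,
    whence an induction on the tree. *)
Lemma exchanged_bitsP (t : protocol_tree T0 TA TB X Y Z) x y w s :
  exchanged_bits t x y w = s <->
  alice_cell t x s (w.1, w.2.1) /\ bob_cell t y s (w.1, w.2.2).
Proof.
elim: t s => [out|m t1 IH1 t0 IH0|m t1 IH1 t0 IH0] [|b s] /=.
- by split.
- by split=> // -[].
- by split=> [|[]//]; case: ifP.
- split.
    by case: ifP => mb [<-]; [move/IH1|move/IH0] => -[Ha Hb]; split=> //; split.
  by move=> [[-> H1] H2]; case: b H1 H2 => H1 H2; congr cons;
    [apply/IH1|apply/IH0].
- by split=> [|[]//]; case: ifP.
- split.
    by case: ifP => mb [<-]; [move/IH1|move/IH0] => -[Ha Hb]; split=> //; split.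
  by move=> [H1 [-> H2]]; case: b H1 H2 => H1 H2; congr cons;
    [apply/IH1|apply/IH0].
Qed.

Lemma tree_outputE (t : protocol_tree T0 TA TB X Y Z) x y w :
  tree_output t x y w = leaf_output t (exchanged_bits t x y w) w.1.
Proof. by elim: t => //= m t1 IH1 t0 IH0; case: ifP. Qed.

Lemma measurable_alice_cell t x s : measurable (alice_cell t x s).
Proof.
elim: t s => [out|m t1 IH1 t0 IH0|m t1 IH1 t0 IH0] [|b s] //=.
- apply: measurableI; last by case: b.
  by rewrite -[X in measurable X]setTI; exact: measurable_funP.
- by case: b.
Qed.

Lemma measurable_bob_cell t y s : measurable (bob_cell t y s).
Proof.
elim: t s => [out|m t1 IH1 t0 IH0|m t1 IH1 t0 IH0] [|b s] //=.
- by case: b.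
- apply: measurableI; last by case: b.
  by rewrite -[X in measurable X]setTI; exact: measurable_funP.
Qed.

Lemma measurable_leaf_output t s : measurable_fun [set: T0] (leaf_output t s).
Proof.
by elim: t s => [out|m t1 IH1 t0 IH0|m t1 IH1 t0 IH0] [|b s] //=; case: b.
Qed.

Lemma measurable_tree_output (t : protocol_tree T0 TA TB X Y Z) x y :
  measurable_fun [set: T0 * (TA * TB)] (tree_output t x y : _ -> discrete Z).
Proof.
elim: t => [out|m t1 mt1 t0 mt0|m t1 mt1 t0 mt0] /=.
- exact: measurableT_comp.
- apply: measurable_fun_ifT => //.
  apply: (measurableT_comp (f := m x)) => //.
  by apply: measurable_fun_pair => //; apply: measurableT_comp.
- apply: measurable_fun_ifT => //.
  apply: (measurableT_comp (f := m y)) => //.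
  by apply: measurable_fun_pair => //; apply: measurableT_comp.
Qed.

(** [D] will be either a set of public coins giving a wrong output at [s], or one where [s] is
    impossible for one of the players. *)
Definition history (t : protocol_tree T0 TA TB X Y Z) x y (D : set T0) s :
    set (T0 * (TA * TB)) :=
  [set w | D w.1 /\ exchanged_bits t x y w = s].

Lemma measurable_history t x y D s : measurable D ->
  measurable (history t x y D s).
Proof.
move=> mD.
have -> : history t x y D s =
    fst @^-1` D `&` ((fun w => (w.1, w.2.1)) @^-1` alice_cell t x s) `&`
    ((fun w => (w.1, w.2.2)) @^-1` bob_cell t y s).
  apply/seteqP; split=> w /=.
    by case=> Dw /exchanged_bitsP[].
  by case=> -[Dw ? ?]; split=> //; exact/exchanged_bitsP.
apply: measurableI; first apply: measurableI.
- by rewrite -[X in measurable X]setTI; exact: measurable_fst.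
- rewrite -[X in measurable X]setTI.
  have : measurable_fun [set: T0 * (TA * TB)] (fun w => (w.1, w.2.1)).
    by apply: measurable_fun_pair => //; apply: measurableT_comp.
  by apply => //; exact: measurable_alice_cell.
- rewrite -[X in measurable X]setTI.
  have : measurable_fun [set: T0 * (TA * TB)] (fun w => (w.1, w.2.2)).
    by apply: measurable_fun_pair => //; apply: measurableT_comp.
  by apply => //; exact: measurable_bob_cell.
Qed.

Context (R : realType) (P0 : probability T0 R) (PA : probability TA R)
  (PB : probability TB R).

(** The measure of the section at r is the factor alpha_{x,s}(r) of the overview; [bob_live] treats
    beta_{y,s}(r) likewise. *)
Definition alice_live (t : protocol_tree T0 TA TB X Y Z) x s : set T0 :=
  [set r | PA (xsection (alice_cell t x s) r) != 0].

Definition bob_live (t : protocol_tree T0 TA TB X Y Z) y s : set T0 :=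
  [set r | PB (xsection (bob_cell t y s) r) != 0].

Lemma measurable_alice_live t x s : measurable (alice_live t x s).
Proof.
rewrite -[X in measurable X]setTI; apply: emeasurable_neq => //.
by apply: measurable_fun_xsection; exact: measurable_alice_cell.
Qed.

Lemma measurable_bob_live t y s : measurable (bob_live t y s).
Proof.
rewrite -[X in measurable X]setTI; apply: emeasurable_neq => //.
by apply: measurable_fun_xsection; exact: measurable_bob_cell.
Qed.

Let coins := product_probability P0 (product_probability PA PB).

(** By Fubini the probability of the history is the integral over [D] of alpha * beta; a nonnegative
    integral vanishes exactly when its integrand does almost everywhere. *)
Lemma history_eq0 t x y D s : measurable D ->
  coins (history t x y D s) = 0 <->
  P0 (D `&` alice_live t x s `&` bob_live t y s) = 0.
Proof.
move=> mD; have mH := measurable_history t x y s mD.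
pose k r := product_probability PA PB (xsection (history t x y D s) r).
have k0 r : 0 <= k r by exact: measure_ge0.
have mk : measurable_fun [set: T0] k by exact: measurable_fun_xsection.
have kE r : D r -> k r =
    PA (xsection (alice_cell t x s) r) * PB (xsection (bob_cell t y s) r).
  move=> Dr; rewrite /k (_ : xsection _ r =
    xsection (alice_cell t x s) r `*` xsection (bob_cell t y s) r).
    rewrite [LHS]product_measure1E//; apply: measurable_xsection.
    - exact: measurable_alice_cell.
    - exact: measurable_bob_cell.
  apply/seteqP; split=> [[a b] /xsectionP[_ /exchanged_bitsP[/= ? ?]]|[a b]].
    by split; apply/xsectionP.
  move=> [/= /xsectionP ? /xsectionP ?]; apply/xsectionP; split=> //.
  exact/exchanged_bitsP.
(* The absolute value only brings the integral to the form expected by [ae_eq_integral_abs]. *)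
have -> : coins (history t x y D s) = \int[P0]_r `|k r|.
  by apply: eq_integral => r _; rewrite gee0_abs.
have -> : D `&` alice_live t x s `&` bob_live t y s = [set r | k r != 0].
  apply/seteqP; split=> [r [[Dr Ar] Br] /=|r /= kr].
    by rewrite kE// mule_neq0.
  have [Dr|nDr] := pselect (D r).
    by move: kr; rewrite kE// mule_eq0 negb_or => /andP[].
  move/eqP: kr; case; rewrite /k (_ : xsection _ r = set0) ?measure0//.
  by apply/seteqP; split=> // ab /xsectionP[].
have mk0 : measurable [set r | k r != 0].
  by rewrite -[X in measurable X]setTI; exact: emeasurable_neq.
rewrite ae_eq_integral_abs//; split=> [|/negligibleP H].
  move=> H; apply/negligibleP => //; apply: negligibleS H => r /= /eqP kr H.
  exact/kr/H.
apply: (@negligibleS _ _ _ _ [set r | k r != 0]); last exact: H.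
by move=> r /= /not_implyP[_ /eqP].
Qed.

End transcript_cells.

(** * Zero-error protocols and the dichotomy on live transcripts *)

Lemma distribution_inputs (R : realType) (X Y Z : finPointedType)
    (mu : probability (discrete (X * Y)%type) R) (pi : protocol R X Y Z) A :
  distribution (joint_law mu pi) (inputs mu pi) A = mu A.
Proof.
have -> : distribution (joint_law mu pi) (inputs mu pi) A =
    joint_law mu pi ([set: _] `*` A).
  by congr (joint_law mu pi _); apply/seteqP; split=> [|] w //= [].
rewrite [LHS]product_measure1E// -[RHS]mul1e; congr (_ * _).
exact: probability_setT.
Qed.

Section zero_error.
Context (R : realType) (X Y Z : finPointedType) (f : X * Y -> Z)
  (mu : probability (discrete (X * Y)%type) R) (pi : protocol R X Y Z).
Hypothesis pi_f : computes pi f.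

Let t := tree pi.
Let PA := alice_law pi.
Let PB := bob_law pi.

(** For such public coins, [s] has positive probability on every pair of the support rectangle,
    including pairs of [mu]-mass 0: this is where the rectangle property matters. *)
Definition all_live s : set (pub_space pi) :=
  \bigcap_(x in support_A mu) alice_live PA t x s `&`
  \bigcap_(y in support_B mu) bob_live PB t y s.

Lemma measurable_all_live s : measurable (all_live s).
Proof.
apply: measurableI.
  by apply: fin_bigcap_measurable => // x _; exact: measurable_alice_live.
by apply: fin_bigcap_measurable => // y _; exact: measurable_bob_live.
Qed.

Let measurable_leaf_output_neq s z :
  measurable [set r | leaf_output t s r <> z].
Proof.
have -> : [set r | leaf_output t s r <> z] =
    [set: _] `&` leaf_output t s @^-1` [set~ z] by rewrite setTI.
exact: measurable_leaf_output.
Qed.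

(** A wrong leaf value on a non-null set of live coins would give input [p] an error of positive
    probability; correctness is required on all inputs, so [p] may have [mu]-mass 0. *)
Lemma all_live_output s p : (support_A mu `*` support_B mu) p ->
  pub_law pi (all_live s `&` [set r | leaf_output t s r <> f p]) = 0.
Proof.
case: p => x y [/= Sx Sy].
set D := _ `&` _.
have mD : measurable D.
  apply: measurableI; first exact: measurable_all_live.
  exact: measurable_leaf_output_neq.
have <- : D `&` alice_live PA t x s `&` bob_live PB t y s = D.
  apply/seteqP; split=> r; first by case=> -[].
  move=> Dr; have [[HA HB] _] := Dr.
  by split; [split=> //; exact: HA|exact: HB].
apply/(history_eq0 (pub_law pi) PA PB t x y s mD).
have mout : measurable [set w | tree_output t x y w = f (x, y)].
  rewrite -[X in measurable X]setTI.
  exact: (@measurable_tree_output _ _ _ _ _ _ _ _ _ t x y measurableT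
    [set f (x, y)] I).
apply: (@subset_measure0 _ _ _ _ _
  (~` [set w | tree_output t x y w = f (x, y)])).
- exact: measurable_history.
- exact: measurableC.
- move=> w [[_ /= ne] ws] /=; rewrite tree_outputE ws; exact: ne.
- by rewrite [LHS](probability_setC (randomness pi) mout)
    [X in 1 - X](pi_f x y) subee.
Qed.

(** The leaf value does not depend on the inputs. If [f] took two values on the rectangle, it would
    differ from one of them at every live coin, covering [all_live s] by two null sets. *)
Lemma all_live_structural s : pub_law pi (all_live s) != 0 ->
  structurally_external_trivial mu f.
Proof.
move=> Gs.
have eqf p q : (support_A mu `*` support_B mu) p ->
    (support_A mu `*` support_B mu) q -> f p = f q.
  move=> Sp Sq; apply: contrapT => fpq.
  move/negP: Gs; apply; apply/eqP/negligibleP; first exact: measurable_all_live.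
  have : (pub_law pi).-negligible
      ((all_live s `&` [set r | leaf_output t s r <> f p]) `|`
       (all_live s `&` [set r | leaf_output t s r <> f q])).
    by apply: negligibleU; apply/negligibleP; try exact: all_live_output;
      apply: measurableI => //; exact: measurable_all_live.
  apply: negligibleS => r Gr; have [rp|rp] := pselect (leaf_output t s r = f p).
    by right; split=> // rq; apply: fpq; rewrite -rp -rq.
  by left.
have [[p Sp]|noS] := pselect (exists p, (support_A mu `*` support_B mu) p).
  by exists (f p) => q Sq; exact: eqf.
by exists (f point) => q Sq; case: noS; exists q.
Qed.

Let N : set (pub_space pi) := \bigcup_s all_live s.

(* Discarding the null set N makes every section, and not only almost every
   section, of [live_pairs] miss an atom of mu or be empty. *)
Let live_pairs :
  set (pub_space pi * discrete (seq bool) * discrete (X * Y)%type) :=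
  [set e | [/\ ~ N e.1.1, alice_live PA t e.2.1 e.1.2 e.1.1 &
               bob_live PB t e.2.2 e.1.2 e.1.1] ].

Let mN : measurable N.
Proof.
apply: countable_bigcupT_measurable => // s; exact: measurable_all_live.
Qed.

Let measurable_live_pairs : measurable live_pairs.
Proof.
have -> : live_pairs = \bigcup_(sp : seq bool * (X * Y))
   (((~` N `&` alice_live PA t sp.2.1 sp.1 `&` bob_live PB t sp.2.2 sp.1)
      `*` [set sp.1]) `*` [set sp.2]).
  apply/seteqP; split=> [[[r s] p] [/= ? ? ?]|[[r s] p]].
    by exists (s, p).
  by move=> [[s' p'] _ [/= [[[? ?] ?] ->] ->]].
apply: countable_bigcupT_measurable => // sp.
apply: measurableX => //; apply: measurableX => //.
apply: measurableI; last exact: measurable_bob_live.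
apply: measurableI; last exact: measurable_alice_live.
exact: measurableC.
Qed.

Lemma ic_ext_ge (m : R) : (0 < m < 1)%R ->
  (forall p, 0 < mu [set p] -> m%:E <= mu [set p]) ->
  (forall s, pub_law pi (all_live s) = 0) ->
  (- log2 (1 - m))%:E <= ic_ext mu pi.
Proof.
move=> /andP[m0 m1] mmin G0.
have N0 : pub_law pi N = 0.
  apply/negligibleP => //; apply: negligible_countable_bigcup => s.
  by apply/negligibleP; [exact: measurable_all_live|exact: G0].
apply: (@kl_divergence_ge _ _ _ _ _ live_pairs) => //.
- by apply/andP; split; lra.
- have mpre : measurable ((pair_rv (transcript mu pi) (inputs mu pi))
      @^-1` (~` live_pairs)).
    rewrite -[X in measurable X]setTI.
    have mp : measurable_fun setT (pair_rv (transcript mu pi) (inputs mu pi)).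
      exact: measurable_funP.
    by apply: mp => //; exact: measurableC.
  change (joint_law mu pi ((pair_rv (transcript mu pi) (inputs mu pi))
    @^-1` (~` live_pairs)) = 0).
  apply: measure_negligible; first exact: mpre.
  (* Outside [N], a triple not in [live_pairs] lies in the history of its own bits over public coins
     where these bits have probability 0. There are countably many such histories, each null by
     [history_eq0]. *)
  pose dead sp : set (pub_space pi) :=
    ~` (alice_live PA t sp.2.1 sp.1 `&` bob_live PB t sp.2.2 sp.1).
  have mdead sp : measurable (dead sp).
    apply: measurableC; apply: measurableI.
    - exact: measurable_alice_live.
    - exact: measurable_bob_live.
  have : (joint_law mu pi).-negligible (((N `*` setT) `*` setT) `|`
      \bigcup_(sp : seq bool * (X * Y))
         (history t sp.2.1 sp.2.2 (dead sp) sp.1 `*` [set sp.2])).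
    apply: negligibleU.
      apply/negligibleP.
        by apply: measurableX => //; exact: measurableX.
      rewrite [LHS]product_measure1E//; last exact: measurableX.
      rewrite [X in X * _](_ : _ = 0) ?mul0e//.
      by rewrite [LHS]product_measure1E// [X in X * _]N0 mul0e.
    apply: negligible_countable_bigcup => -[s [x y]] /=.
    have mH := measurable_history t x y s (mdead (s, (x, y))).
    apply/negligibleP; first exact: measurableX.
    rewrite [LHS]product_measure1E//.
    rewrite [X in X * _](_ : _ = 0) ?mul0e//.
      apply/(history_eq0 (pub_law pi) PA PB t x y s (mdead _)).
      rewrite (_ : _ `&` _ = set0) ?measure0//.
      by apply/seteqP; split=> // r [[+ Ar] Br]; apply.
  apply: negligibleS => -[w p] /= nlive.
  have [Nw|nNw] := pselect (N w.1); first by left.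
  right; exists (exchanged_bits t p.1 p.2 w, p) => //.
  split=> //; split=> // -[HA HB]; exact: nlive.
(* Under the product of the marginals, the mass of [live_pairs] is the mean over the transcript of
   the [mu]-mass of its section. *)
- rewrite [X in X <= _](_ : _ =
      \int[distribution (joint_law mu pi) (transcript mu pi)]_e
        mu (xsection live_pairs e)); last first.
    apply: eq_integral => e _; rewrite [LHS]/=.
    exact: distribution_inputs.
  set M := distribution _ _.
  apply: (@le_trans _ _ (\int[M]_e (1 - m)%:E)); last first.
    by rewrite integral_cst// [X in _ * X]probability_setT mule1.
  apply: ge0_le_integral => //.
  + exact: measurable_fun_xsection.
  + move=> [r s] _.
    (* A section that misses an atom of [mu] loses at least its mass, hence at least m. *)
    have bound p : 0 < mu [set p] -> ~ live_pairs ((r, s), p) ->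
        mu (xsection live_pairs (r, s)) <= (1 - m)%:E.
      move=> mup nlive.
      apply: (@le_trans _ _ (mu (~` [set p]))).
        apply: le_measure; rewrite ?inE//.
        by move=> q /xsectionP + /= qp; rewrite qp.
      rewrite probability_setC// EFinB; apply: leeB => //; exact: mmin.
    have [Nr|nNr] := pselect (N r).
      rewrite (_ : xsection _ _ = set0) ?measure0 ?lee_fin; first lra.
      by apply/seteqP; split=> // p /xsectionP[].
    (* Some x in [support_A] or y in [support_B] is incompatible with (r, s); any atom of [mu] with
       that coordinate is then missed. *)
    have : ~ all_live s r by move=> Gr; apply: nNr; exists s.
    move=> /not_andP[|] /existsNP[z /not_implyP[Sz nlive]].
      have [p /= pz mup] := @exists_atom R X Y mu [set q | q.1 = z] Sz.
      by apply: (bound p) => // -[/= _ + _]; rewrite pz.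
    have [p /= pz mup] := @exists_atom R X Y mu [set q | q.2 = z] Sz.
    by apply: (bound p) => // -[/= _ _]; rewrite pz.
Qed.

End zero_error.

(** * A protocol of zero cost in the structural case *)

Lemma mutual_info_ae_cst d d1 d2 (T : measurableType d)
    (T1 : measurableType d1) (T2 : measurableType d2) (R : realType)
    (P : probability T R) (U : {RV P >-> T1}) (V : {RV P >-> T2}) (c : T1) :
  {ae P, forall t, U t = c} -> mutual_info U V = 0.
Proof.
move=> Uc; apply: kl_divergence_eq0 => A mA; apply/esym.
(* It suffices to compare the two laws on rectangles: both give P(V in C) if [c] is in [B], and 0
   otherwise. *)
rewrite [LHS](product_measure_unique (m' := distribution P (pair_rv U V)))//.
move=> B C mB mC.
have mU D : measurable D -> measurable (U @^-1` D).
  by move=> mD; rewrite -[X in measurable X]setTI; exact: measurable_funP.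
have mV : measurable (V @^-1` C).
  by rewrite -[X in measurable X]setTI; exact: measurable_funP.
rewrite [LHS](_ : _ = P (V @^-1` C `&` U @^-1` B)); last first.
  by congr (P _); apply/seteqP; split=> t [].
change (P (V @^-1` C `&` U @^-1` B) = P (U @^-1` B) * P (V @^-1` C)).
have out0 D : measurable D -> ~ D c -> P (U @^-1` D) = 0.
  move=> mD nDc; apply: measure_negligible; first exact: mU.
  by apply: negligibleS Uc => t /= DUt Utc; apply: nDc; rewrite -Utc.
have [Bc|nBc] := pselect (B c); last first.
  rewrite [X in X * _](out0 B)// mul0e.
  apply: (@subset_measure0 _ _ _ _ _ (U @^-1` B));
    [|exact: mU|by []|exact: out0].
  by apply: measurableI => //; exact: mU.
have UB0 : P (U @^-1` (~` B)) = 0 by apply: out0 => //; exact: measurableC.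
have -> : P (U @^-1` B) = 1.
  rewrite -[B]setCK [LHS](probability_setC P (mU _ (measurableC mB))).
  by rewrite UB0 sube0.
rewrite mul1e [RHS](measureDI P mV (mU _ mB)).
rewrite [X in _ = X + _](_ : _ = 0) ?add0e//.
apply: (@subset_measure0 _ _ _ _ _ (U @^-1` (~` B))) => //.
- by apply: measurableD => //; exact: mU.
- by apply: mU; exact: measurableC.
Qed.

Section structural_protocol.
Context (R : realType) (X Y Z : finPointedType).

Let ptree := protocol_tree unit unit unit X Y Z.

(** A message from a finite alphabet, encoded as successive yes/no questions because a node carries
    one bit. The answers are constant in the coins: the protocol is deterministic. *)
Fixpoint ask_alice (s : seq X) (k : X -> ptree) (t : ptree) : ptree :=
  if s is a :: s' then
    Alice (fun x => cst (x == a) : {mfun (unit * unit)%type >-> bool})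
      (k a) (ask_alice s' k t)
  else t.

Fixpoint ask_bob (s : seq Y) (k : Y -> ptree) (t : ptree) : ptree :=
  if s is b :: s' then
    Bob (fun y => cst (y == b) : {mfun (unit * unit)%type >-> bool})
      (k b) (ask_bob s' k t)
  else t.

Lemma ask_alice_output s k t x y w :
  tree_output (ask_alice s k t) x y w =
  tree_output (if x \in s then k x else t) x y w.
Proof.
by elim: s => //= a s IH; rewrite inE; case: eqVneq => //= ->.
Qed.

Lemma ask_bob_output s k t x y w :
  tree_output (ask_bob s k t) x y w =
  tree_output (if y \in s then k y else t) x y w.
Proof.
by elim: s => //= a s IH; rewrite inE; case: eqVneq => //= ->.
Qed.

Lemma ask_alice_bits s k t x y w : x \notin s ->
  exchanged_bits (ask_alice s k t) x y w =
  nseq (size s) false ++ exchanged_bits t x y w.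
Proof.
by elim: s => //= a s IH; rewrite inE negb_or => /andP[/negbTE -> /IH ->].
Qed.

Lemma ask_bob_bits s k t x y w : y \notin s ->
  exchanged_bits (ask_bob s k t) x y w =
  nseq (size s) false ++ exchanged_bits t x y w.
Proof.
by elim: s => //= a s IH; rewrite inE negb_or => /andP[/negbTE -> /IH ->].
Qed.

Definition answer (z : Z) : ptree :=
  Leaf unit unit X Y (cst z : {mfun unit >-> discrete Z}).

(* A player whose input is off the support names it, after which the other
   reveals the other input; on the support only refusals are exchanged. *)
Definition structural_tree (f : X * Y -> Z) (SA : set X) (SB : set Y) (z : Z) :
    ptree :=
  ask_alice [seq x <- enum X | x \notin SA]
    (fun a => ask_bob (enum Y) (fun b => answer (f (a, b))) (answer z))
    (ask_bob [seq y <- enum Y | y \notin SB]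
       (fun b => ask_alice (enum X) (fun a => answer (f (a, b))) (answer z))
       (answer z)).

(** If an input is off the support, both inputs end up named, since [enum] exhausts the type of the
    second player, and the leaf carries the value of [f]; otherwise [z] is that value. *)
Lemma structural_tree_output f SA SB z x y w :
  (forall p, (SA `*` SB) p -> f p = z) ->
  tree_output (structural_tree f SA SB z) x y w = f (x, y).
Proof.
move=> fz; rewrite ask_alice_output mem_filter mem_enum andbT.
have [xA|xA] /= := boolP (x \in SA); last by rewrite ask_bob_output mem_enum.
rewrite ask_bob_output mem_filter mem_enum andbT.
have [yB|yB] /= := boolP (y \in SB); last by rewrite ask_alice_output mem_enum.
by rewrite fz//; split; [exact: set_mem xA|exact: set_mem yB].
Qed.

Lemma structural_tree_bits f (SA : set X) (SB : set Y) z :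
  exists s, forall x y w, SA x -> SB y ->
    exchanged_bits (structural_tree f SA SB z) x y w = s.
Proof.
exists (nseq (size [seq x <- enum X | x \notin SA]) false ++
        nseq (size [seq y <- enum Y | y \notin SB]) false ++ [::]).
move=> x y w /mem_set xA /mem_set yB.
by rewrite ask_alice_bits ?mem_filter ?xA// ask_bob_bits ?mem_filter ?yB.
Qed.

Definition structural_protocol f SA SB z : protocol R X Y Z :=
  Protocol (dirac tt : probability unit R) (dirac tt : probability unit R)
    (dirac tt : probability unit R) (structural_tree f SA SB z).

Context (mu : probability (discrete (X * Y)%type) R).

(** An atom outside the rectangle would give positive mass to both of its marginals. *)
Lemma off_support_eq0 :
  mu (~` (support_A mu `*` support_B mu)) = 0.
Proof.
apply/eqP; rewrite eq_le measure_ge0 andbT leNgt; apply/negP => /exists_atom.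
move=> [[x y] /= nS mup]; apply: nS; split; apply: lt_le_trans mup _;
  by apply: le_measure; rewrite ?inE// => _ ->.
Qed.

Lemma structurally_strongly (f : X * Y -> Z) :
  structurally_external_trivial mu f -> strongly_external_trivial mu f.
Proof.
move=> [z fz]; exists (structural_protocol f (support_A mu) (support_B mu) z).
  move=> x y; rewrite (_ : [set w | _] = setT) ?probability_setT//.
  by apply/seteqP; split=> // w _ /=; rewrite structural_tree_output.
have [s bits] := structural_tree_bits f (support_A mu) (support_B mu) z.
set pi := structural_protocol _ _ _ _.
apply: (@mutual_info_ae_cst _ _ _ _ _ _ _ _ (transcript mu pi) (inputs mu pi)
  ((tt, s) : pub_space pi * discrete (seq bool))).
(* The transcript is constant except when the inputs leave the support rectangle, an event of
   [mu]-mass 0. *)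
exists (setT `*` ~` (support_A mu `*` support_B mu)); split.
- exact: measurableX.
- by rewrite [LHS]product_measure1E// [X in _ * X]off_support_eq0 mule0.
- move=> [[[] w] [x y]] /= ne; split=> // -[/= xA yB]; apply: ne.
  by rewrite /tree_transcript/= bits.
Qed.

End structural_protocol.

(** * The implications between the three notions *)

Lemma ic_ext_ge0 (R : realType) (X Y Z : finPointedType)
    (mu : probability (discrete (X * Y)%type) R) (pi : protocol R X Y Z) :
  0 <= ic_ext mu pi.
Proof. exact: kl_divergence_ge0. Qed.

Lemma strongly_external (R : realType) (X Y Z : finPointedType)
    (f : X * Y -> Z) (mu : probability (discrete (X * Y)%type) R) :
  strongly_external_trivial mu f -> external_trivial mu f.
Proof.
move=> [pi pif pi0]; apply/eqP; rewrite eq_le; apply/andP; split.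
  by apply: ereal_inf_lbound; exists pi.
by apply/ereal_infP => _ [pi' _ ->]; exact: ic_ext_ge0.
Qed.

Lemma external_structurally (R : realType) (X Y Z : finPointedType)
    (f : X * Y -> Z) (mu : probability (discrete (X * Y)%type) R) :
  external_trivial mu f -> structurally_external_trivial mu f.
Proof.
move=> inf0; have [m m01 mmin] := exists_min_atom mu.
have pos : 0 < (- log2 (1 - m))%:E.
  rewrite lte_fin oppr_gt0 /log2 pmulr_llt0.
    by rewrite ln_lt0//; lra.
  by rewrite invr_gt0 ln_gt0// ltr1n.
(* The threshold does not depend on the protocol, so an infimum equal to 0, attained or not, yields
   a correct protocol strictly below it. *)
move: pos; rewrite -inf0 => /ereal_inf_lt[_ [pi pif ->]] small.
have [G0|/existsNP[s /eqP Gs]] :=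
  pselect (forall s, pub_law pi (all_live mu s) = 0).
  by have := lt_le_trans small (ic_ext_ge m01 mmin G0); rewrite ltxx.
exact: all_live_structural Gs.
Qed.

Theorem mainTheorem16 (R : realType) (X Y Z : finPointedType)
    (f : X * Y -> Z) (mu : probability (discrete (X * Y)%type) R) :
  (external_trivial mu f <-> strongly_external_trivial mu f) /\
  (strongly_external_trivial mu f <-> structurally_external_trivial mu f).
Proof.
split; split.
- by move/external_structurally; exact: structurally_strongly.
- exact: strongly_external.
- by move/strongly_external; exact: external_structurally.
- exact: structurally_strongly.
Qed.
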